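(* Assume the consistency of ZF. Then there is a model of $\mathrm{ZFU}_{\mathrm{R}}$ in which Tail$^*$ holds, Collection fails, and Tail fails.
   Context: The language of urelement set theory has $\in$ and a unary predicate $\mathcal{A}$ for urelements. $\mathrm{ZFU}_{\mathrm{R}}$ = ZU (urelements have no members, Extensionality for sets, Foundation, Pairing, Union, Powerset, Infinity, Separation scheme) + Replacement scheme. Tail$^*$: for every set $A$ of urelements there is a greatest (well-ordered) cardinal $\kappa$ such that some set of urelements equinumerous with $\kappa$ is disjoint from $A$. Tail: every set $A$ of urelements has a tail, i.e. a set $B$ of urelements disjoint from $A$ such that every set of urelements disjoint from $A$ injects into $B$. Collection: for every formula $\varphi$, $\forall w,u(\forall x\in w\,\exists y\,\varphi(x,y,u)\to\exists v\,\forall x\in w\,\exists y\in v\,\varphi(x,y,u))$. *)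

(* Defs.v *)
From Stdlib Require Import List PeanoNat.
Import ListNotations.

Set Implicit Arguments.
Unset Strict Implicit.
Unset Printing Implicit Defensive.

(* First-order logic with equality, the binary symbol ∈, and one unary predicate
   symbol for each element of [U].  There are no function symbols, so terms are
   variables, written as de Bruijn indices, and substitution is renaming. *)
Inductive form (U : Type) : Type :=
| Bot : form U
| Eq  : nat -> nat -> form U
| In  : nat -> nat -> form U
| Prd : U -> nat -> form U
| Imp : form U -> form U -> form U
| And : form U -> form U -> form U
| Or  : form U -> form U -> form U
| All : form U -> form U
| Ex  : form U -> form U.

Arguments Bot {U}.
Arguments Eq {U} _ _.
Arguments In {U} _ _.

Declare Scope fm_scope.
Delimit Scope fm_scope with fm.
Bind Scope fm_scope with form.

Infix "≐" := Eq (at level 50, no associativity) : fm_scope.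
Infix "∈" := In (at level 50, no associativity) : fm_scope.
Notation "¬ φ" := (Imp φ%fm Bot) (at level 60, right associativity) : fm_scope.
Infix "∧" := And (at level 65, right associativity) : fm_scope.
Infix "∨" := Or (at level 67, right associativity) : fm_scope.
Infix "⇒" := Imp (at level 70, right associativity) : fm_scope.
Notation "φ ⇔ ψ" := (And (Imp φ%fm ψ%fm) (Imp ψ%fm φ%fm))
  (at level 72, no associativity) : fm_scope.

Local Open Scope fm_scope.

(* The language {∈}, and the language {∈, 𝒜}. *)
Definition form_in := form Empty_set.
Definition form_ur := form unit.

Definition theory (U : Type) := form U -> Prop.

Definition scons (X : Type) (x : X) (s : nat -> X) (n : nat) : X :=
  match n with 0 => x | S k => s k end.

Definition up (r : nat -> nat) : nat -> nat := scons 0 (fun n => S (r n)).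

Fixpoint ren (U : Type) (r : nat -> nat) (φ : form U) : form U :=
  match φ with
  | Bot => Bot
  | Eq x y => Eq (r x) (r y)
  | In x y => In (r x) (r y)
  | Prd p x => Prd p (r x)
  | Imp φ ψ => Imp (ren r φ) (ren r ψ)
  | And φ ψ => And (ren r φ) (ren r ψ)
  | Or φ ψ => Or (ren r φ) (ren r ψ)
  | All φ => All (ren (up r) φ)
  | Ex φ => Ex (ren (up r) φ)
  end.

Definition shift (U : Type) (φ : form U) : form U := ren S φ.

Definition inst (U : Type) (x : nat) (φ : form U) : form U :=
  ren (scons x (fun n => n)) φ.

(* The least [n] such that all free variables of [φ] are below [n]. *)
Fixpoint fvb (U : Type) (φ : form U) : nat :=
  match φ with
  | Bot => 0
  | Eq x y | In x y => Nat.max (S x) (S y)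
  | Prd _ x => S x
  | Imp φ ψ | And φ ψ | Or φ ψ => Nat.max (fvb φ) (fvb ψ)
  | All φ | Ex φ => Nat.pred (fvb φ)
  end.

Definition closure (U : Type) (φ : form U) : form U :=
  Nat.iter (fvb φ) (@All U) φ.

(* Classical natural deduction from a theory of sentences; in [prv T Γ φ], [Γ]
   lists the open assumptions. *)
Inductive prv (U : Type) (T : theory U) : list (form U) -> form U -> Prop :=
| Ax Γ φ : T φ -> prv T Γ φ
| Hyp Γ φ : List.In φ Γ -> prv T Γ φ
| Contra Γ φ : prv T ((¬ φ) :: Γ) Bot -> prv T Γ φ
| ImpI Γ φ ψ : prv T (φ :: Γ) ψ -> prv T Γ (φ ⇒ ψ)
| ImpE Γ φ ψ : prv T Γ (φ ⇒ ψ) -> prv T Γ φ -> prv T Γ ψ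
| AndI Γ φ ψ : prv T Γ φ -> prv T Γ ψ -> prv T Γ (φ ∧ ψ)
| AndE1 Γ φ ψ : prv T Γ (φ ∧ ψ) -> prv T Γ φ
| AndE2 Γ φ ψ : prv T Γ (φ ∧ ψ) -> prv T Γ ψ
| OrI1 Γ φ ψ : prv T Γ φ -> prv T Γ (φ ∨ ψ)
| OrI2 Γ φ ψ : prv T Γ ψ -> prv T Γ (φ ∨ ψ)
| OrE Γ φ ψ χ : prv T Γ (φ ∨ ψ) -> prv T (φ :: Γ) χ -> prv T (ψ :: Γ) χ -> prv T Γ χ
| AllI Γ φ : prv T (map (@shift U) Γ) φ -> prv T Γ (All φ)
| AllE Γ φ x : prv T Γ (All φ) -> prv T Γ (inst x φ)
| ExI Γ φ x : prv T Γ (inst x φ) -> prv T Γ (Ex φ)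
| ExE Γ φ ψ : prv T Γ (Ex φ) -> prv T (φ :: map (@shift U) Γ) (shift ψ) -> prv T Γ ψ
| EqI Γ x : prv T Γ (x ≐ x)
| EqE Γ φ x y : prv T Γ (x ≐ y) -> prv T Γ (inst x φ) -> prv T Γ (inst y φ).

Definition consistent (U : Type) (T : theory U) : Prop := ~ prv T [] Bot.

Record structure (U : Type) : Type := Structure {
  carrier :> Type;
  mem : carrier -> carrier -> Prop;
  prd : U -> carrier -> Prop;
  nonempty : inhabited carrier
}.

Fixpoint sat (U : Type) (M : structure U) (e : nat -> M) (φ : form U) : Prop :=
  match φ with
  | Bot => False
  | Eq x y => e x = e y
  | In x y => mem (e x) (e y)
  | Prd p x => prd p (e x)
  | Imp φ ψ => sat e φ -> sat e ψ
  | And φ ψ => sat e φ /\ sat e ψ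
  | Or φ ψ => sat e φ \/ sat e ψ
  | All φ => forall d : M, sat (scons d e) φ
  | Ex φ => exists d : M, sat (scons d e) φ
  end.

Definition holds (U : Type) (M : structure U) (φ : form U) : Prop :=
  forall e : nat -> M, sat e φ.

Definition models (U : Type) (M : structure U) (T : theory U) : Prop :=
  forall φ, T φ -> holds M φ.

(* [skip m k] makes room for [k] additional bound variables just above the
   variables [0, ..., m-1]. *)
Definition skip (m k n : nat) : nat := if n <? m then n else k + n.

Section SetFormulas.
Context {U : Type}.
Implicit Types (φ : form U) (x y z p f A B C w : nat).

(* The bodies of bounded quantifiers live in the extended context: variable 0 is
   the bound one, and the bound [x] is taken in the outer context. *)
Definition all_in x φ : form U := All (0 ∈ S x ⇒ φ).
Definition ex_in x φ : form U := Ex (0 ∈ S x ∧ φ).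

Definition subset x y : form U := all_in x (0 ∈ S y).
Definition empty x : form U := All (¬ 0 ∈ S x).
Definition disjoint x y : form U := ¬ ex_in x (0 ∈ S y).

(* p = {x, y} *)
Definition is_upair p x y : form U := All (0 ∈ S p ⇔ (0 ≐ S x ∨ 0 ≐ S y)).

(* p = {{x}, {x, y}} *)
Definition is_opair p x y : form U :=
  All (0 ∈ S p ⇔ (is_upair 0 (S x) (S x) ∨ is_upair 0 (S x) (S y))).

(* y = x ∪ {x} *)
Definition is_succ y x : form U := All (0 ∈ S y ⇔ (0 ∈ S x ∨ 0 ≐ S x)).

(* ⟨x, y⟩ ∈ f *)
Definition maps f x y : form U := ex_in f (is_opair 0 (S x) (S y)).

Definition Pairing : form U := All (All (Ex (is_upair 0 1 2))).

Definition Union : form U := All (Ex (All (0 ∈ 1 ⇔ ex_in 2 (1 ∈ 0)))).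

Definition Foundation : form U :=
  All (Ex (0 ∈ 1) ⇒ ex_in 0 (disjoint 0 1)).

(* In the schemes below, [φ] is φ(x, y, u) with y = variable 0, x = variable 1
   and the parameters u = the variables from 2 on; the outermost universal
   quantifiers of the axiom are added by [closure].

   ∀w (∀x∈w ∃!y φ → ∃v ∀x∈w ∃y∈v φ) *)
Definition Replacement_inst φ : form U :=
  All (all_in 0 (Ex (ren (skip 2 1) φ
                     ∧ All (ren (scons 0 (scons 2 (fun n => 4 + n))) φ ⇒ 0 ≐ 1)))
       ⇒ Ex (all_in 1 (ex_in 1 (ren (skip 2 2) φ)))).

(* ∀w (∀x∈w ∃y φ → ∃v ∀x∈w ∃y∈v φ) *)
Definition Collection_inst φ : form U :=
  All (all_in 0 (Ex (ren (skip 2 1) φ))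
       ⇒ Ex (all_in 1 (ex_in 1 (ren (skip 2 2) φ)))).

End SetFormulas.

Definition ZF_Extensionality : form_in :=
  All (All (All (0 ∈ 1 ⇔ 0 ∈ 2) ⇒ 0 ≐ 1)).

Definition ZF_Powerset : form_in :=
  All (Ex (All (0 ∈ 1 ⇔ subset 0 2))).

Definition ZF_Infinity : form_in :=
  Ex (ex_in 0 (empty 0) ∧ all_in 0 (ex_in 1 (is_succ 0 1))).

(* φ(z, u) with z = variable 0:  ∀x ∃y ∀z (z ∈ y ↔ z ∈ x ∧ φ) *)
Definition ZF_Separation_inst (φ : form_in) : form_in :=
  All (Ex (All (0 ∈ 1 ⇔ (0 ∈ 2 ∧ ren (skip 1 2) φ)))).

Inductive ZF : theory Empty_set :=
| ZF_ext : ZF ZF_Extensionality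
| ZF_fnd : ZF Foundation
| ZF_pair : ZF Pairing
| ZF_union : ZF Union
| ZF_pow : ZF ZF_Powerset
| ZF_inf : ZF ZF_Infinity
| ZF_sep φ : ZF (closure (ZF_Separation_inst φ))
| ZF_repl φ : ZF (closure (Replacement_inst φ)).

Definition Urel (x : nat) : form_ur := Prd tt x.
Definition IsSet (x : nat) : form_ur := ¬ Urel x.

Definition Urelements : form_ur := All (Urel 0 ⇒ ¬ Ex (0 ∈ 1)).

Definition Extensionality : form_ur :=
  All (All (IsSet 0 ∧ IsSet 1 ∧ All (0 ∈ 1 ⇔ 0 ∈ 2) ⇒ 0 ≐ 1)).

Definition Powerset : form_ur :=
  All (Ex (IsSet 0 ∧ All (0 ∈ 1 ⇔ (IsSet 0 ∧ subset 0 2)))).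

Definition Infinity : form_ur :=
  Ex (ex_in 0 (IsSet 0 ∧ empty 0) ∧ all_in 0 (ex_in 1 (is_succ 0 1))).

(* φ(z, u) with z = variable 0, as in [ZF_Separation_inst]. *)
Definition Separation_inst (φ : form_ur) : form_ur :=
  All (Ex (IsSet 0 ∧ All (0 ∈ 1 ⇔ (0 ∈ 2 ∧ ren (skip 1 2) φ)))).

Inductive ZU : theory unit :=
| ZU_ur : ZU Urelements
| ZU_ext : ZU Extensionality
| ZU_fnd : ZU Foundation
| ZU_pair : ZU Pairing
| ZU_union : ZU Union
| ZU_pow : ZU Powerset
| ZU_inf : ZU Infinity
| ZU_sep φ : ZU (closure (Separation_inst φ)).

Inductive ZFU_R : theory unit :=
| ZFU_R_ZU φ : ZU φ -> ZFU_R φ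
| ZFU_R_repl φ : ZFU_R (closure (Replacement_inst φ)).

Inductive Collection : theory unit :=
| Coll φ : Collection (closure (Collection_inst φ)).

Definition is_function (f A B : nat) : form_ur :=
  IsSet f
  ∧ all_in f (ex_in (S A) (ex_in (S (S B)) (is_opair 2 1 0)))
  ∧ all_in A (Ex (maps (S (S f)) 1 0
                  ∧ All (maps (S (S (S f))) 2 0 ⇒ 0 ≐ 1))).

Definition is_injection (f A B : nat) : form_ur :=
  is_function f A B
  ∧ All (All (All (maps (S (S (S f))) 2 0 ∧ maps (S (S (S f))) 1 0 ⇒ 2 ≐ 1))).

Definition is_bijection (f A B : nat) : form_ur :=
  is_injection f A B ∧ all_in B (Ex (maps (S (S f)) 0 1)).

Definition injects (A B : nat) : form_ur := Ex (is_injection 0 (S A) (S B)).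
Definition equinumerous (A B : nat) : form_ur := Ex (is_bijection 0 (S A) (S B)).

(* Von Neumann ordinals: transitive sets of sets linearly ordered by ∈ (the
   order is well-founded by Foundation).  Urelements must be excluded as members
   explicitly: {a} is transitive and linearly ordered for every urelement a. *)
Definition is_ordinal (x : nat) : form_ur :=
  IsSet x
  ∧ all_in x (IsSet 0 ∧ subset 0 (S x))
  ∧ all_in x (all_in (S x) (1 ∈ 0 ∨ 1 ≐ 0 ∨ 0 ∈ 1)).

(* Well-ordered cardinals are initial ordinals. *)
Definition is_cardinal (x : nat) : form_ur :=
  is_ordinal x ∧ all_in x (¬ equinumerous 0 (S x)).

Definition set_of_urelements (x : nat) : form_ur :=
  IsSet x ∧ all_in x (Urel 0).

Definition is_tail (B A : nat) : form_ur :=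
  set_of_urelements B ∧ disjoint B A
  ∧ All (set_of_urelements 0 ∧ disjoint 0 (S A) ⇒ injects 0 (S B)).

Definition Tail : form_ur := All (set_of_urelements 0 ⇒ Ex (is_tail 0 1)).

(* k is a cardinal, and some set of urelements equinumerous with k is disjoint
   from A. *)
Definition cardinal_outside (k A : nat) : form_ur :=
  is_cardinal k
  ∧ Ex (set_of_urelements 0 ∧ equinumerous 0 (S k) ∧ disjoint 0 (S A)).

Definition Tail_star : form_ur :=
  All (set_of_urelements 0 ⇒
       Ex (cardinal_outside 0 1
           ∧ All (cardinal_outside 0 2 ⇒ (0 ∈ 1 ∨ 0 ≐ 1)))).

(* Main.v *)
(** The type theory itself provides a universe of sets with atoms: well-founded trees whose leaves
    are atoms, modulo bisimulation. The model is a Fraenkel-Mostowski submodel of it. The atoms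
    form pairs: pair number [l] of copy [j] of kind [i], with sides [true] and [false]. The group
    consists of the flips [p], which swap the sides of all copies of pair [l] of kind [i] at once
    when [p i l]. A set is kept if, hereditarily and for some [n], it only uses atoms of copy 0 or
    of kind and copy below [n], and it is fixed by the flips that are trivial on kind 0 and on the
    pairs number [l < n].

    Exchanging two copies of one kind commutes with all flips, hence acts on the model;
    exchanging a copy with remote ones shows that the unique solution of a formula uses no atoms
    beyond the bound [n] of its parameters, which gives Replacement. Each copy of kind 0 is
    pointwise fixed, so countable in the model, and there are only countably many atoms
    altogether, so the greatest well-ordered cardinal is always omega. For [i > 0] the set of
    atoms of kind [i] and copy 0 injects into that of copy 1, but into no set that avoids the atoms
    of kind [i]; as a set disjoint from copy 0 only meets finitely many kinds, Tail fails at the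
    set of all atoms of copy 0, and Collection fails for the family of its kinds. *)
From Stdlib Require Import List PeanoNat Lia Bool Wellfounded Cantor FinFun Classical ClassicalEpsilon
  FunctionalExtensionality PropExtensionality.
Require Import Defs.

(** * Atoms, flips and exchanges of copies *)

Record atom : Type := Atom { kind : nat; copy : nat; index : nat; side : bool }.

Definition flip (p : nat -> nat -> bool) (a : atom) : atom :=
  Atom (kind a) (copy a) (index a) (xorb (p (kind a) (index a)) (side a)).

Definition trivial_below (n : nat) (p : nat -> nat -> bool) : Prop :=
  forall i l, i = 0 \/ l < n -> p i l = false.

Definition low (n : nat) (a : atom) : Prop :=
  copy a = 0 \/ (kind a < n /\ copy a < n).

Lemma low_mono n m a : n <= m -> low n a -> low m a.
Proof. unfold low; lia. Qed.

Lemma trivial_below_mono n m p : n <= m -> trivial_below m p -> trivial_below n p.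
Proof. intros le H i l h; apply H; lia. Qed.

Lemma flip_flip p a : flip p (flip p a) = a.
Proof. destruct a as [i j l b]; unfold flip; cbn; now destruct (p i l), b. Qed.

Lemma flip_comm p q a : flip p (flip q a) = flip q (flip p a).
Proof. destruct a as [i j l b]; unfold flip; cbn; now destruct (p i l), (q i l), b. Qed.

(** Flips and exchanges of copies are all involutions, so no separate inverse is carried. Commuting
    with flips preserves invariance under them, and the last field keeps the atoms in use bounded;
    together they make the action preserve hereditary symmetry. *)
Record symmetry : Type := Symmetry {
  sfun :> atom -> atom;
  symmetry_invol : forall a, sfun (sfun a) = a;
  symmetry_flip : forall p a, sfun (flip p a) = flip p (sfun a);
  symmetry_low : forall n, exists m, forall a, low n a -> low m (sfun a)
}.

Definition flipS (p : nat -> nat -> bool) : symmetry.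
Proof.
  refine (@Symmetry (flip p) (flip_flip p) (flip_comm p) _).
  intros n; exists n; intros a; exact (fun h => h).
Defined.

Definition transp (j j' k : nat) : nat :=
  if k =? j then j' else if k =? j' then j else k.

Lemma transp_transp j j' k : transp j j' (transp j j' k) = k.
Proof.
  unfold transp.
  destruct (Nat.eqb_spec k j); [|destruct (Nat.eqb_spec k j')];
    repeat (match goal with |- context [?a =? ?b] => destruct (Nat.eqb_spec a b) end); lia.
Qed.

Lemma transp_le j j' k : transp j j' k <= k + j + j'.
Proof.
  unfold transp.
  repeat (match goal with |- context [?a =? ?b] => destruct (Nat.eqb_spec a b) end); lia.
Qed.

(** Whether a flip changes the side of an atom depends only on its kind and index, so changing the
    copy commutes with every flip. *)
Definition swap (i j j' : nat) (a : atom) : atom :=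
  if kind a =? i then Atom (kind a) (transp j j' (copy a)) (index a) (side a) else a.

Definition swapS (i j j' : nat) : symmetry.
Proof.
  refine (@Symmetry (swap i j j') _ _ _).
  - intros [k c l b]; unfold swap; cbn.
    destruct (k =? i) eqn:E; cbn; rewrite E; [now rewrite transp_transp | easy].
  - intros p [k c l b]; unfold swap, flip; cbn; now destruct (k =? i).
  - intros n; exists (n + S i + j + j' + 1); intros [k c l b]; unfold swap, low; cbn.
    destruct (Nat.eqb_spec k i); cbn; pose proof (transp_le j j' c); lia.
Defined.

(** * Trees with atoms modulo bisimulation *)

Inductive V : Type :=
| At : atom -> V
| St : forall X : Type, (X -> V) -> V.
Arguments St {X} f.

Fixpoint eqv (x y : V) : Prop :=
  match x, y with
  | At a, At b => a = b
  | St f, St g => (forall i, exists j, eqv (f i) (g j)) /\ (forall j, exists i, eqv (f i) (g j))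
  | _, _ => False
  end.

Definition memV (y x : V) : Prop :=
  match x with At _ => False | St f => exists i, eqv y (f i) end.

Lemma eqv_refl x : eqv x x.
Proof. induction x as [|X f IH]; cbn; [easy | split; intros i; now exists i]. Qed.

Lemma eqv_sym x y : eqv x y -> eqv y x.
Proof.
  revert y; induction x as [a|X f IH]; intros [b|Y g]; cbn; try easy.
  intros [H1 H2]; split.
  - intros j; destruct (H2 j) as [i h]; exists i; auto.
  - intros i; destruct (H1 i) as [j h]; exists j; auto.
Qed.

Lemma eqv_trans x y z : eqv x y -> eqv y z -> eqv x z.
Proof.
  revert y z; induction x as [a|X f IH]; intros [b|Y g] [c|Z k]; cbn; try easy.
  - congruence.
  - intros [H1 H2] [K1 K2]; split.
    + intros i; destruct (H1 i) as [j h]; destruct (K1 j) as [l h']; exists l; eauto.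
    + intros l; destruct (K2 l) as [j h]; destruct (H2 j) as [i h']; exists i; eauto.
Qed.

Lemma memV_eqv y y' x x' : eqv y y' -> eqv x x' -> memV y x -> memV y' x'.
Proof.
  destruct x as [a|X f], x' as [a'|X' f']; cbn; try easy.
  intros E [H _] [i h]; destruct (H i) as [j h']; exists j.
  eauto using eqv_sym, eqv_trans.
Qed.

Lemma eqv_ext (X Y : Type) (f : X -> V) (g : Y -> V) :
  (forall y, memV y (St f) <-> memV y (St g)) -> eqv (St f) (St g).
Proof.
  intros H; split.
  - intros i; apply (H (f i)); exists i; apply eqv_refl.
  - intros j; destruct (proj2 (H (g j))) as [i h]; [exists j; apply eqv_refl|].
    exists i; now apply eqv_sym.
Qed.

Lemma memV_wf : well_founded memV.
Proof.
  intros x; induction x as [a|X f IH]; constructor; [easy|].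
  intros y [i h]; constructor; intros z hz.
  apply (IH i); exact (memV_eqv _ _ _ _ (eqv_refl z) h hz).
Qed.

(** * The action on trees, supports and hereditary symmetry *)

Fixpoint actV (f : atom -> atom) (x : V) : V :=
  match x with At a => At (f a) | St g => St (fun i => actV f (g i)) end.

Fixpoint lowV (n : nat) (x : V) : Prop :=
  match x with At a => low n a | St g => forall i, lowV n (g i) end.

Lemma actV_eqv f x y : eqv x y -> eqv (actV f x) (actV f y).
Proof.
  revert y; induction x as [a|X g IH]; intros [b|Y k]; cbn; try easy.
  - congruence.
  - intros [H1 H2]; split.
    + intros i; destruct (H1 i) as [j h]; exists j; auto.
    + intros j; destruct (H2 j) as [i h]; exists i; auto.
Qed.

Lemma actV_comp f g x : actV f (actV g x) = actV (fun a => f (g a)) x.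
Proof. induction x as [a|X k IH]; cbn; [easy|]. f_equal; extensionality i; auto. Qed.

Lemma actV_fix n f x : lowV n x -> (forall a, low n a -> f a = a) -> actV f x = x.
Proof.
  intros H Hf; induction x as [a|X k IH]; cbn in *; [now rewrite Hf|].
  f_equal; extensionality i; auto.
Qed.

Lemma actV_id f x : (forall a, f a = a) -> actV f x = x.
Proof.
  intros Hf; induction x as [a|X k IH]; cbn in *; [now rewrite Hf|].
  f_equal; extensionality i; auto.
Qed.

Lemma lowV_eqv n x y : eqv x y -> lowV n x -> lowV n y.
Proof.
  revert y; induction x as [a|X g IH]; intros [b|Y k]; cbn; try easy.
  - now intros [].
  - intros [_ H] K j; destruct (H j) as [i h]; eauto.
Qed.

Lemma lowV_mono n m x : n <= m -> lowV n x -> lowV m x.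
Proof. intros le; induction x; cbn; eauto using low_mono. Qed.

Lemma lowV_act (n m : nat) (f : atom -> atom) x :
  (forall a, low n a -> low m (f a)) -> lowV n x -> lowV m (actV f x).
Proof. intros le; induction x; cbn; eauto. Qed.

Definition supports (n : nat) (x : V) : Prop :=
  lowV n x /\ forall p, trivial_below n p -> eqv (actV (flip p) x) x.

Fixpoint hs (x : V) : Prop :=
  match x with
  | At _ => True
  | St f => (exists n, supports n x) /\ forall i, hs (f i)
  end.

Lemma hs_supports x : hs x -> exists n, supports n x.
Proof.
  destruct x as [[i j l b]|X f]; [|now intros []].
  (* The bound exceeds kind, copy and index at once: the first two make the atom low, the last keeps
     its pair unflipped. *)
  intros _; exists (S (i + j + l)); split; cbn.
  - unfold low; cbn; lia.
  - intros p H; unfold flip; cbn. rewrite (H i l); [easy | lia].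
Qed.

Lemma supports_eqv n x y : eqv x y -> supports n x -> supports n y.
Proof.
  intros E [L H]; split; [exact (lowV_eqv _ _ _ E L)|].
  intros p hp; specialize (H p hp).
  eauto using eqv_trans, eqv_sym, actV_eqv.
Qed.

Lemma hs_eqv x y : eqv x y -> hs x -> hs y.
Proof.
  revert y; induction x as [a|X f IH]; intros [b|Y g] E; try easy.
  intros [[n H] K]; split.
  - exists n; exact (supports_eqv _ _ _ E H).
  - intros j; destruct E as [_ E]; destruct (E j) as [i h]; eauto.
Qed.

(** Since [f] commutes with flips, the flips fixing [x] also fix its image; only the bound on the
    atoms may grow. *)
Lemma supports_act (f : symmetry) n x :
  supports n x -> exists m, supports m (actV f x).
Proof.
  intros [L H]; destruct (symmetry_low f n) as [m Hm]; exists (max n m); split.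
  - apply (lowV_mono m); [lia|]; exact (lowV_act _ _ _ _ Hm L).
  - intros p hp. rewrite actV_comp.
    replace (fun a => flip p (f a)) with (fun a => f (flip p a))
      by (extensionality a; apply symmetry_flip).
    rewrite <- (actV_comp f); apply actV_eqv, H.
    apply (trivial_below_mono n (max n m)); [lia | exact hp].
Qed.

Lemma hs_act (f : symmetry) x : hs x -> hs (actV f x).
Proof.
  induction x as [a|X g IH]; [easy|]; intros [[n H] K]; split.
  - exact (supports_act f _ _ H).
  - intros i; auto.
Qed.

(* The symmetric universe: classes of hereditarily symmetric trees modulo bisimulation. *)
Definition W : Type := { c : V -> Prop | exists x, hs x /\ c = eqv x }.

Definition cls (x : V) (h : hs x) : W :=
  exist _ (eqv x) (ex_intro _ x (conj h eq_refl)).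

Definition repr (w : W) : V :=
  proj1_sig (constructive_indefinite_description _ (proj2_sig w)).

Lemma repr_spec w : hs (repr w) /\ proj1_sig w = eqv (repr w).
Proof. exact (proj2_sig (constructive_indefinite_description _ (proj2_sig w))). Qed.

Lemma repr_cls x h : eqv x (repr (cls x h)).
Proof.
  destruct (repr_spec (cls x h)) as [_ E]; cbn [proj1_sig cls] in E.
  rewrite E; apply eqv_refl.
Qed.

(** Bisimilar trees have the same class as a predicate, so bisimilarity becomes genuine equality, by
    which [sat] interprets [Eq]. *)
Lemma W_eq a b : eqv (repr a) (repr b) -> a = b.
Proof.
  intros E; apply eq_sig_hprop; [intros; apply proof_irrelevance|].
  rewrite (proj2 (repr_spec a)), (proj2 (repr_spec b)).
  extensionality z; apply propositional_extensionality.
  split; eauto using eqv_trans, eqv_sym.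
Qed.

Definition mem (a b : W) : Prop := memV (repr a) (repr b).

Definition ur (a : atom) : W := cls (At a) I.

Definition is_ur (x : W) : Prop := exists a, x = ur a.

Definition lowW (n : nat) (x : W) : Prop := lowV n (repr x).

Definition act (f : symmetry) (x : W) : W :=
  cls (actV f (repr x)) (hs_act f _ (proj1 (repr_spec x))).

Lemma repr_act f x : eqv (repr (act f x)) (actV f (repr x)).
Proof. apply eqv_sym, repr_cls. Qed.

Lemma repr_ur a : repr (ur a) = At a.
Proof.
  pose proof (repr_cls (At a) I) as E; unfold ur.
  destruct (repr (cls (At a) I)); cbn in E; [now subst | easy].
Qed.

Lemma ur_inj a b : ur a = ur b -> a = b.
Proof. intros E; apply (f_equal repr) in E; rewrite !repr_ur in E; congruence. Qed.

Lemma not_mem_ur x a : ~ mem x (ur a).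
Proof. unfold mem; now rewrite repr_ur. Qed.

Lemma mem_wf : well_founded mem.
Proof. apply (wf_inverse_image _ _ memV repr), memV_wf. Qed.

(** The branches of a representative are hereditarily symmetric themselves, hence yield a small
    index type for the members, as [comprehension] will require. *)
Lemma repr_nur x : ~ is_ur x -> exists (X : Type) (f : X -> W),
  (forall y, mem y x <-> exists i, y = f i) /\ exists g : X -> V, repr x = St g.
Proof.
  intros H; destruct (repr_spec x) as [h _].
  destruct (repr x) as [a|X f] eqn:E.
  - destruct H; exists a; apply W_eq; rewrite E, repr_ur; apply eqv_refl.
  - destruct h as [_ h]; exists X, (fun i => cls (f i) (h i)); split; [|now exists f].
    intros y; unfold mem; rewrite E; split; intros [i K]; exists i.
    + apply W_eq; eapply eqv_trans; [exact K|apply repr_cls].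
    + subst y; apply eqv_sym, repr_cls.
Qed.

Lemma W_ext x y : ~ is_ur x -> ~ is_ur y -> (forall z, mem z x <-> mem z y) -> x = y.
Proof.
  intros hx hy H; apply W_eq.
  assert (K : forall z, memV z (repr x) <-> memV z (repr y)).
  (* The hypothesis speaks only of members in [W]; every tree that is a member of a representative
     is hereditarily symmetric, so inclusions pass to trees. *)
  { assert (S : forall x y, (forall z, mem z x -> mem z y) -> forall z, memV z (repr x) -> memV z (repr y)).
    { clear; intros x y H z hz.
      assert (h : hs z).
      { destruct (repr_spec x) as [h _]; destruct (repr x) as [|X f]; [easy|].
        destruct hz as [i E], h as [_ h]; exact (hs_eqv _ _ (eqv_sym _ _ E) (h i)). }
      apply (memV_eqv (repr (cls z h)) z (repr y) (repr y));
        [apply eqv_sym, repr_cls | apply eqv_refl |].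
      apply (H (cls z h)); unfold mem.
      exact (memV_eqv _ _ _ _ (repr_cls z h) (eqv_refl _) hz). }
    split; apply S; apply H. }
  destruct (repr_nur x hx) as (X & _ & _ & f & E), (repr_nur y hy) as (Y & _ & _ & g & F).
  rewrite E, F in *; now apply eqv_ext.
Qed.

Lemma act_invol f x : act f (act f x) = x.
Proof.
  apply W_eq; eapply eqv_trans; [apply repr_act|].
  eapply eqv_trans; [apply actV_eqv, repr_act|].
  rewrite actV_comp, actV_id; [apply eqv_refl | apply symmetry_invol].
Qed.

Lemma act_ur f a : act f (ur a) = ur (f a).
Proof.
  apply W_eq; eapply eqv_trans; [apply repr_act|]; rewrite !repr_ur; apply eqv_refl.
Qed.

Lemma mem_act f x y : mem x y -> mem (act f x) (act f y).
Proof.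
  intros H; unfold mem.
  eapply memV_eqv; [apply eqv_sym, repr_act | apply eqv_sym, repr_act |].
  unfold mem in H; destruct (repr y) as [a|Y g]; [easy|].
  destruct H as [i h]; exists i; now apply actV_eqv.
Qed.

Lemma lowW_ur n a : lowW n (ur a) <-> low n a.
Proof. unfold lowW; now rewrite repr_ur. Qed.

Lemma lowW_mem n x y : lowW n x -> mem y x -> lowW n y.
Proof.
  unfold lowW, mem; destruct (repr x) as [a|X g]; [easy|].
  intros L [i h]; exact (lowV_eqv _ _ _ (eqv_sym _ _ h) (L i)).
Qed.

Lemma lowW_set n x : ~ is_ur x -> (forall y, mem y x -> lowW n y) -> lowW n x.
Proof.
  intros h H; destruct (repr_nur x h) as (X & _ & _ & f & E).
  unfold lowW; rewrite E; intros i.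
  assert (hf : hs (f i)).
  { destruct (repr_spec x) as [h' _]; rewrite E in h'; apply h'. }
  apply (lowV_eqv n (repr (cls (f i) hf))); [apply eqv_sym, repr_cls|].
  apply H; unfold mem; rewrite E; exists i; apply eqv_sym, repr_cls.
Qed.

Lemma act_fix n (f : symmetry) x :
  lowW n x -> (forall a, low n a -> f a = a) -> act f x = x.
Proof.
  intros L H; apply W_eq; eapply eqv_trans; [apply repr_act|].
  rewrite (actV_fix n); [apply eqv_refl | exact L | exact H].
Qed.

Definition supported (n : nat) (x : W) : Prop :=
  lowW n x /\ forall p, trivial_below n p -> act (flipS p) x = x.

Lemma supported_ex x : exists n, supported n x.
Proof.
  destruct (hs_supports (repr x) (proj1 (repr_spec x))) as (n & L & H).
  exists n; split; [exact L|]; intros p hp; apply W_eq.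
  eapply eqv_trans; [apply repr_act | exact (H p hp)].
Qed.

Lemma supported_mono n m x : n <= m -> supported n x -> supported m x.
Proof.
  intros le [L H]; split; [exact (lowV_mono _ _ _ le L)|].
  intros p hp; apply H; exact (trivial_below_mono _ _ _ le hp).
Qed.

(* Every set-existence axiom of the model reduces to this principle. *)
Lemma comprehension (P : W -> Prop) (X : Type) (f : X -> W) (n : nat) :
  (forall y, P y -> exists i, y = f i) ->
  (forall y, P y -> lowW n y) ->
  (forall p y, trivial_below n p -> P y -> P (act (flipS p) y)) ->
  exists z, ~ is_ur z /\ forall y, mem y z <-> P y.
Proof.
  intros small L H.
  set (x := St (fun i : { i : X | P (f i) } => repr (f (proj1_sig i)))).
  assert (h : hs x).
  { split; [|intros i; apply repr_spec].
    exists n; split; [intros [i h]; exact (L _ h)|].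
    intros p hp; split; intros [i h].
    - destruct (small _ (H p _ hp h)) as [j E].
      assert (hj : P (f j)) by (rewrite <- E; auto).
      exists (exist _ j hj); cbn; rewrite <- E; apply repr_cls.
    (* Flips are involutions, so the preimage of [f i] is its own image under the flip, which again
       satisfies [P]. *)
    - destruct (small _ (H p _ hp h)) as [j E].
      assert (hj : P (f j)) by (rewrite <- E; auto).
      exists (exist _ j hj); cbn; rewrite <- E.
      eapply eqv_trans; [apply actV_eqv, (repr_act (flipS p))|].
      cbn [flipS sfun]; rewrite actV_comp, actV_id by apply flip_flip; apply eqv_refl. }
  exists (cls x h); split.
  - intros [a E]; apply (f_equal repr) in E; rewrite repr_ur in E.
    pose proof (repr_cls x h) as K; rewrite E in K; easy.
  - intros y; unfold mem; split.
    + intros K; apply (memV_eqv _ (repr y) _ x (eqv_refl _)) in K;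
        [|apply eqv_sym, repr_cls].
      destruct K as [[i hi] K]; cbn in K; apply W_eq in K; now subst.
    + intros K; destruct (small _ K) as [i E]; subst y.
      apply (memV_eqv (repr (f i)) _ x); [apply eqv_refl | apply repr_cls |].
      exists (exist _ i K); apply eqv_refl.
Qed.

Lemma mem_act_iff f x y : mem (act f x) (act f y) <-> mem x y.
Proof.
  split; [|apply mem_act].
  intros H; apply (mem_act f) in H; now rewrite !act_invol in H.
Qed.

Lemma is_ur_act f x : is_ur (act f x) <-> is_ur x.
Proof.
  assert (H : forall y, is_ur y -> is_ur (act f y)).
  { intros y [a ->]; exists (f a); apply act_ur. }
  split; [|apply H]; intros h; apply H in h; now rewrite act_invol in h.
Qed.

Lemma elements x : exists (X : Type) (f : X -> W), forall y, mem y x <-> exists i, y = f i.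
Proof.
  destruct (classic (is_ur x)) as [[a ->]|h].
  - exists Empty_set, (fun i : Empty_set => match i with end); intros y; split.
    + intros K; destruct (not_mem_ur _ _ K).
    + now intros [[] _].
  - destruct (repr_nur x h) as (X & f & H & _); now exists X, f.
Qed.

(** A choice of index types uniform in [x]; Union sums them over the members of a set. *)
Definition branch (x : W) : Type :=
  proj1_sig (constructive_indefinite_description _ (elements x)).

Definition child (x : W) : branch x -> W :=
  proj1_sig (constructive_indefinite_description _
    (proj2_sig (constructive_indefinite_description _ (elements x)))).

Lemma mem_child x y : mem y x <-> exists i, y = child x i.
Proof.
  unfold child.
  exact (proj2_sig (constructive_indefinite_description _
    (proj2_sig (constructive_indefinite_description _ (elements x)))) y).
Qed.

Lemma mem_minimal (P : W -> Prop) x : P x -> exists y, P y /\ forall z, mem z y -> ~ P z.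
Proof.
  induction x as [x IH] using (well_founded_ind mem_wf); intros h.
  destruct (classic (exists z, mem z x /\ P z)) as [(z & hz & hP)|H].
  - exact (IH z hz hP).
  - exists x; split; [easy|]; intros z hz hP; apply H; now exists z.
Qed.

Lemma mem_irrefl x : ~ mem x x.
Proof.
  induction x as [x IH] using (well_founded_ind mem_wf); intros h; exact (IH x h h).
Qed.

Lemma mem_not_ur x y : mem x y -> ~ is_ur y.
Proof. intros h [a ->]; exact (not_mem_ur _ _ h). Qed.

(** * Pairs, numerals, graphs and sets of atoms *)

Definition collects (z : W) (P : W -> Prop) : Prop :=
  ~ is_ur z /\ forall y, mem y z <-> P y.

Lemma collects_unique z z' P : collects z P -> collects z' P -> z = z'.
Proof.
  intros [h H] [h' H']; apply W_ext; [easy..|].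
  intros y; now rewrite H, H'.
Qed.

(** The value is unspecified when no element of [W] collects [P]. Being total, the operator can
    index candidate subsets by arbitrary predicates, as the proof of Powerset does. *)
Definition setof (P : W -> Prop) : W :=
  epsilon (inhabits (ur (Atom 0 0 0 false))) (fun z => collects z P).

Lemma setof_spec P : (exists z, collects z P) -> collects (setof P) P.
Proof. exact (epsilon_spec _ (fun z => collects z P)). Qed.

Lemma lowW_mono n m x : n <= m -> lowW n x -> lowW m x.
Proof. apply lowV_mono. Qed.

Lemma lowW_ex x : exists n, lowW n x.
Proof. destruct (supported_ex x) as (n & h & _); now exists n. Qed.

Definition upair (x y : W) : W := setof (fun z => z = x \/ z = y).

Lemma upair_spec x y : collects (upair x y) (fun z => z = x \/ z = y).
Proof.
  apply setof_spec.
  destruct (supported_ex x) as (n & Ln & Hn), (supported_ex y) as (m & Lm & Hm).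
  apply (comprehension _ bool (fun b => if b then x else y) (max n m)).
  - intros z [->| ->]; [now exists true | now exists false].
  - intros z [->| ->]; [apply (lowW_mono n) | apply (lowW_mono m)]; auto; lia.
  - intros p z hp [->| ->]; [left; apply Hn | right; apply Hm];
      (eapply trivial_below_mono; [|exact hp]; lia).
Qed.

Lemma mem_upair z x y : mem z (upair x y) <-> z = x \/ z = y.
Proof. apply upair_spec. Qed.

Lemma act_upair f x y : act f (upair x y) = upair (act f x) (act f y).
Proof.
  apply W_ext; rewrite ?is_ur_act; try apply upair_spec.
  intros z; rewrite <- (act_invol f z), mem_act_iff, !mem_upair, act_invol.
  split; intros [E|E]; [left|right|left|right]; subst; rewrite ?act_invol; try easy.
  all: now rewrite <- E, act_invol.
Qed.

Definition opair (x y : W) : W := upair (upair x x) (upair x y).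

Lemma act_opair f x y : act f (opair x y) = opair (act f x) (act f y).
Proof. unfold opair; now rewrite !act_upair. Qed.

Lemma lowW_upair n x y : lowW n x -> lowW n y -> lowW n (upair x y).
Proof.
  intros hx hy; apply lowW_set; [apply upair_spec|].
  intros z hz; apply mem_upair in hz; now destruct hz; subst.
Qed.

Lemma lowW_opair n x y : lowW n x -> lowW n y -> lowW n (opair x y).
Proof. intros; now repeat apply lowW_upair. Qed.

Lemma upair_inj x y z : upair x y = upair x z -> y = z.
Proof.
  intros E.
  assert (h : mem y (upair x z)) by (rewrite <- E; apply mem_upair; now right).
  assert (k : mem z (upair x y)) by (rewrite E; apply mem_upair; now right).
  apply mem_upair in h, k; destruct h, k; congruence.
Qed.

Lemma opair_inj x y x' y' : opair x y = opair x' y' -> x = x' /\ y = y'.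
Proof.
  intros E.
  assert (Ex : x = x').
  { assert (h : mem (upair x x) (opair x' y')) by (rewrite <- E; apply mem_upair; now left).
    apply mem_upair in h.
    assert (k : mem x' (upair x x)).
    { destruct h as [-> | ->]; apply mem_upair; now left. }
    apply mem_upair in k; now destruct k. }
  subst x'; split; [easy|].
  exact (upair_inj _ _ _ (upair_inj _ _ _ E)).
Qed.

Definition zero : W := setof (fun _ => False).

Lemma zero_spec : collects zero (fun _ => False).
Proof.
  apply setof_spec.
  now apply (comprehension _ Empty_set (fun i : Empty_set => match i with end) 0).
Qed.

Definition succ (x : W) : W := setof (fun z => mem z x \/ z = x).

Lemma succ_spec x : collects (succ x) (fun z => mem z x \/ z = x).
Proof.
  apply setof_spec.
  destruct (elements x) as (X & f & Hf), (supported_ex x) as (n & L & H).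
  apply (comprehension _ (option X) (fun o => match o with Some i => f i | None => x end) n).
  - intros y [h| ->]; [|now exists None].
    apply Hf in h; destruct h as [i ->]; now exists (Some i).
  - intros y [h| ->]; [exact (lowW_mem _ _ _ L h) | easy].
  - intros p y hp [h| ->]; [left | right; now apply H].
    apply (mem_act (flipS p)) in h; now rewrite (H p hp) in h.
Qed.

Fixpoint num (k : nat) : W := match k with 0 => zero | S k => succ (num k) end.

Lemma num_nur k : ~ is_ur (num k).
Proof. destruct k; [apply zero_spec | apply succ_spec]. Qed.

Lemma mem_num y k : mem y (num k) <-> exists i, i < k /\ y = num i.
Proof.
  induction k as [|k IH]; cbn [num].
  - rewrite (proj2 zero_spec); split; [easy | intros (i & h & _); lia].
  - rewrite (proj2 (succ_spec _)), IH; split.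
    + intros [(i & h & ->)| ->]; [exists i | exists k]; split; easy || lia.
    + intros (i & h & ->); destruct (Nat.eq_dec i k) as [->|n]; [now right|].
      left; exists i; split; easy || lia.
Qed.

Lemma num_inj i j : num i = num j -> i = j.
Proof.
  intros E; destruct (Nat.lt_total i j) as [h|[h|h]]; [|easy|]; exfalso.
  - apply (mem_irrefl (num i)); rewrite E at 2; apply mem_num; now exists i.
  - apply (mem_irrefl (num j)); rewrite <- E at 2; apply mem_num; now exists j.
Qed.

Lemma act_num f k : act f (num k) = num k.
Proof.
  induction k as [k IH] using (well_founded_ind Nat.lt_wf_0).
  apply W_ext; rewrite ?is_ur_act; try apply num_nur.
  intros y; rewrite <- (act_invol f y), mem_act_iff, !mem_num.
  split; intros (i & h & E); exists i; (split; [easy|]).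
  - now rewrite E, IH.
  - rewrite <- (act_invol f (act f y)), E; now apply IH.
Qed.

Lemma lowW_num n k : lowW n (num k).
Proof.
  induction k as [k IH] using (well_founded_ind Nat.lt_wf_0).
  apply lowW_set; [apply num_nur|].
  intros y h; apply mem_num in h; destruct h as (i & h & ->); now apply IH.
Qed.

Definition omega : W := setof (fun z => exists k, z = num k).

Lemma omega_spec : collects omega (fun z => exists k, z = num k).
Proof.
  apply setof_spec, (comprehension _ nat num 0); [easy|..].
  - intros y [k ->]; apply lowW_num.
  - intros p y _ [k ->]; exists k; apply act_num.
Qed.

Lemma mem_omega y : mem y omega <-> exists k, y = num k.
Proof. apply omega_spec. Qed.

Definition graph {X : Type} (F G : X -> W) : W :=
  setof (fun z => exists i, z = opair (F i) (G i)).

(** A flip may permute the pairs of the graph: it suffices that argument and value move to the same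
    new index. *)
Lemma graph_spec (X : Type) (F G : X -> W) n :
  (forall i, lowW n (F i) /\ lowW n (G i)) ->
  (forall p i, trivial_below n p ->
     exists i', act (flipS p) (F i) = F i' /\ act (flipS p) (G i) = G i') ->
  collects (graph F G) (fun z => exists i, z = opair (F i) (G i)).
Proof.
  intros L H; apply setof_spec.
  apply (comprehension _ X (fun i => opair (F i) (G i)) n); [easy|..].
  - intros y [i ->]; apply lowW_opair; apply L.
  - intros p y hp [i ->]; destruct (H p i hp) as (i' & E & E').
    exists i'; now rewrite act_opair, E, E'.
Qed.

Definition urset (Q : atom -> Prop) : W := setof (fun z => exists a, Q a /\ z = ur a).

Lemma urset_spec (Q : atom -> Prop) n :
  (forall a, Q a -> low n a) ->
  (forall p a, trivial_below n p -> Q a -> Q (flip p a)) ->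
  collects (urset Q) (fun z => exists a, Q a /\ z = ur a).
Proof.
  intros L H; apply setof_spec, (comprehension _ atom ur n).
  - intros y (a & _ & ->); now exists a.
  - intros y (a & h & ->); apply lowW_ur; auto.
  - intros p y hp (a & h & ->); exists (flip p a); split; [auto | apply act_ur].
Qed.

(** * The model and the axioms of ZFU with Replacement *)

Definition M : structure unit := Structure mem (fun _ => is_ur) (inhabits omega).

Lemma sat_ren (e : nat -> M) r (phi : form_ur) :
  sat e (ren r phi) <-> sat (fun n => e (r n)) phi.
Proof.
  assert (U : forall (d : M) r e, (fun n => scons d e (up r n)) = scons d (fun n => e (r n))).
  { intros; extensionality n; now destruct n. }
  revert e r; induction phi; intros e r; cbn [ren sat]; try easy;
    rewrite ?IHphi1, ?IHphi2; try easy.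
  - split; intros H d; specialize (H d); [rewrite IHphi, U in H | rewrite IHphi, U]; exact H.
  - split; intros [d H]; exists d; [rewrite IHphi, U in H | rewrite IHphi, U]; exact H.
Qed.

Lemma sat_ren_eq (e e' : nat -> M) r (phi : form_ur) :
  (forall n, e (r n) = e' n) -> (sat e (ren r phi) <-> sat e' phi).
Proof.
  intros H; rewrite sat_ren; replace (fun n => e (r n)) with e'; [easy|].
  now extensionality n.
Qed.

(** Symmetries are automorphisms of the model; at quantifiers, surjectivity comes from being an
    involution. Only variables below [fvb phi] matter, so finitely many parameters with a common
    support decide the truth of [phi]. *)
Lemma sat_act (f : symmetry) (phi : form_ur) (e e' : nat -> M) :
  (forall k, k < fvb phi -> act f (e k) = e' k) -> (sat e phi <-> sat e' phi).
Proof.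
  revert e e'; induction phi as [|x y|x y|u x|p IHp q IHq|p IHp q IHq|p IHp q IHq|p IHp|p IHp];
    intros e e' H; cbn [sat fvb] in *.
  - easy.
  - rewrite <- (H x), <- (H y) by lia.
    split; [now intros -> |]; intros E; apply (f_equal (act f)) in E.
    now rewrite !act_invol in E.
  - rewrite <- (H x), <- (H y) by lia; symmetry; apply mem_act_iff.
  - rewrite <- (H x) by lia; symmetry; apply is_ur_act.
  - rewrite (IHp e e'), (IHq e e'); try easy; intros; apply H; lia.
  - rewrite (IHp e e'), (IHq e e'); try easy; intros; apply H; lia.
  - rewrite (IHp e e'), (IHq e e'); try easy; intros; apply H; lia.
  - assert (K : forall d : M, sat (scons d e) p <-> sat (scons (act f d : M) e') p).
    { intros d; apply IHp; intros [|k] h; [easy | apply H; lia]. }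
    split; intros S d; [|now apply K].
    specialize (S (act f d)); apply K in S; now rewrite act_invol in S.
  - assert (K : forall d : M, sat (scons d e) p <-> sat (scons (act f d : M) e') p).
    { intros d; apply IHp; intros [|k] h; [easy | apply H; lia]. }
    split; intros [d S]; exists (act f d); [now apply K|].
    apply K; now rewrite act_invol.
Qed.

Lemma holds_All (phi : form_ur) : holds M (All phi) <-> holds M phi.
Proof.
  split; [|intros H e d; apply H].
  intros H e; specialize (H (fun n => e (S n)) (e 0)).
  replace e with (scons (e 0) (fun n => e (S n))); [exact H|].
  extensionality n; now destruct n.
Qed.

Lemma holds_closure (phi : form_ur) : holds M (Defs.closure phi) <-> holds M phi.
Proof.
  unfold Defs.closure; generalize (fvb phi); intros n.
  induction n as [|n IH]; cbn; [easy|]; now rewrite holds_All.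
Qed.

Lemma supported_env (e : nat -> W) m : exists n, forall k, k < m -> supported n (e k).
Proof.
  induction m as [|m [n H]]; [exists 0; lia|].
  destruct (supported_ex (e m)) as [n' H']; exists (max n n').
  intros k h; destruct (Nat.eq_dec k m) as [->|hk].
  - apply (supported_mono n'); [lia | easy].
  - apply (supported_mono n); [lia | apply H; lia].
Qed.

Lemma mem_act_supported n p x y :
  supported n x -> trivial_below n p -> mem y x -> mem (act (flipS p) y) x.
Proof. intros [_ H] hp h; apply (mem_act (flipS p)) in h; now rewrite (H p hp) in h. Qed.

Lemma M_Separation phi : holds M (Separation_inst phi).
Proof.
  intros e w; cbn [sat].
  destruct (supported_ex w) as (n & Hw), (supported_env e (fvb phi)) as (m & He).
  apply (supported_mono n (max n m)) in Hw; [|lia].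
  destruct (elements w) as (X & f & Hf).
  destruct (comprehension (fun y => mem y w /\ sat (M := M) (scons y e) phi) X f (max n m))
    as (z & hz & Hz).
  - intros y [h _]; now apply Hf.
  - intros y [h _]; destruct Hw; eapply lowW_mem; eauto.
  - intros p y hp [h S]; split; [apply (mem_act_supported (max n m)); assumption|].
    revert S; refine (proj1 (sat_act (flipS p) _ _ _ _)).
    intros [|k] hk; cbn [scons]; [reflexivity|].
    assert (Hk : k < fvb phi) by lia.
    apply (He k Hk); eapply trivial_below_mono; [|exact hp]; lia.
  - exists z; split; [exact hz|]; intros y.
    specialize (Hz y); rewrite (sat_ren_eq _ (scons (y : M) e)) by now intros [].
    exact (conj (proj1 Hz) (proj2 Hz)).
Qed.

(* If [x] had an atom that is not low, swapping its copy with a remote one would push it beyond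
   any prescribed bound [m]. *)
Lemma low_by_swaps n m x :
  (forall f : symmetry, (forall a, low n a -> f a = a) -> lowV m (actV f x)) -> lowV n x.
Proof.
  induction x as [[i j l b]|X g IH]; intros H.
  - apply NNPP; cbn; intros K.
    (* Copy [S (n + m)] lies beyond both bounds: the swap fixes every atom that is low for [n] and
       takes the given one to an atom that is not low for [m]. *)
    assert (Hf : forall a, low n a -> swapS i j (S (n + m)) a = a).
    { intros [i' j' l' b']; cbn; unfold swap, low, transp in *; cbn in *; intros h.
      destruct (Nat.eqb_spec i' i); [|easy].
      destruct (Nat.eqb_spec j' j); [lia|].
      destruct (Nat.eqb_spec j' (S (n + m))); [lia|easy]. }
    specialize (H _ Hf); cbn in H; unfold swap, low, transp in H; cbn in H.
    rewrite !Nat.eqb_refl in H; cbn in H; lia.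
  - intros i; apply IH; intros f Hf; exact (H f Hf i).
Qed.

Lemma low_of_fixed n x :
  (forall f : symmetry, (forall a, low n a -> f a = a) -> act f x = x) -> lowW n x.
Proof.
  intros H; destruct (lowW_ex x) as [m L].
  apply (low_by_swaps n m); intros f Hf.
  apply (lowV_eqv m (repr (act f x))); [apply repr_act|].
  now rewrite (H f Hf).
Qed.

(** An image is definable from a member of [w] and the parameters, so it is fixed by every symmetry
    fixing the atoms that are low for a common support [N]. By [low_of_fixed] all images obey the
    one bound [N], and invariance under flips follows likewise from definability. *)
Lemma M_Replacement phi : holds M (Replacement_inst phi).
Proof.
  intros e w; cbn [sat all_in ex_in]; intros H.
  destruct (supported_ex w) as (n & Hw), (supported_env e (fvb phi)) as (m & He).
  set (N := max n m).
  assert (Hw' : supported N w) by (apply (supported_mono n); [lia | easy]).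
  assert (He' : forall k, k < fvb phi -> supported N (e k)).
  { intros k hk; apply (supported_mono m); [lia | auto]. }
  set (R := fun x y : W => sat (M := M) (scons y (scons x e)) phi).
  assert (HR : forall x, mem x w -> exists y, R x y /\ forall y', R x y' -> y' = y).
  { intros x hx; destruct (H x hx) as (y & S & U); exists y; split.
    - rewrite (sat_ren_eq _ (scons (y : M) (scons x e))) in S by now intros [|[]].
      exact S.
    - intros y' S'; specialize (U y').
      rewrite (sat_ren_eq _ (scons (y' : M) (scons x e))) in U by now intros [|[]].
      exact (U S'). }
  clear H.
  assert (Hact : forall (f : symmetry) x y, (forall k, k < fvb phi -> act f (e k) = e k) ->
                   R x y -> R (act f x) (act f y)).
  { intros f x y Hf; unfold R; refine (proj1 (sat_act f _ _ _ _)).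
    intros [|[|k]] hk; cbn [scons]; [reflexivity..|]; apply Hf; lia. }
  destruct (elements w) as (X & g & Hg).
  destruct (comprehension (fun y => exists x, mem x w /\ R x y) X
              (* On members of [w] the unique image is what [epsilon] returns, so the images are
                 indexed by the branches of [w]. *)
              (fun i => epsilon (inhabits zero) (R (g i))) N) as (v & hv & Hv).
  - intros y (x & hx & hR); destruct (proj1 (Hg x) hx) as [i ->]; exists i.
    destruct (HR _ hx) as (y0 & h0 & U).
    rewrite (U y hR); symmetry; apply U, epsilon_spec; now exists y.
  - intros y (x & hx & hR); apply low_of_fixed; intros f Hf.
    destruct (HR _ hx) as (y0 & h0 & U); rewrite (U y hR); apply U.
    rewrite <- (act_fix N f x); [|exact (lowW_mem _ _ _ (proj1 Hw') hx)|exact Hf].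
    rewrite <- (U y hR); apply Hact; [|exact hR].
    intros k hk; apply (act_fix N); [apply (He' k hk) | exact Hf].
  - intros p y hp (x & hx & hR); exists (act (flipS p) x); split.
    + apply (mem_act_supported N); assumption.
    + apply Hact; [|exact hR]; intros k hk; now apply (He' k hk).
  - exists v; intros x hx; cbn [scons] in hx.
    destruct (HR x hx) as (y & hR & _); exists y; split.
    + apply Hv; now exists x.
    + rewrite (sat_ren_eq _ (scons (y : M) (scons x e))) by now intros [|[]].
      exact hR.
Qed.

Lemma M_ZU phi : ZU phi -> holds M phi.
Proof.
  intros [ | | | | | | | psi].
  - intros e x [a E] [y hy]; cbn in E, hy; rewrite E in hy; exact (not_mem_ur _ _ hy).
  - intros e x y; cbn; intros (hy & hx & H); apply W_ext; [exact hy | exact hx |].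
    intros z; exact (conj (proj1 (H z)) (proj2 (H z))).
  - intros e x [y hy]; cbn in hy; destruct (mem_minimal (fun y => mem y x) y hy) as (z & hz & H).
    exists z; split; [exact hz|]; intros (t & ht & ht'); exact (H t ht ht').
  - intros e x y; exists (upair y x); intros z; cbn; exact (mem_upair z y x).
  - intros e x; cbn.
    destruct (supported_ex x) as (n & Hx), (elements x) as (X & f & Hf).
    destruct (comprehension (fun z => exists y, mem y x /\ mem z y) {i : X & branch (f i)}
                (fun c => child (f (projT1 c)) (projT2 c)) n) as (u & _ & Hu).
    + intros z (y & hy & hz); destruct (proj1 (Hf y) hy) as [i ->].
      apply mem_child in hz; destruct hz as [j ->]; now exists (existT _ i j).
    + intros z (y & hy & hz); exact (lowW_mem _ _ _ (lowW_mem _ _ _ (proj1 Hx) hy) hz).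
    + intros p z hp (y & hy & hz); exists (act (flipS p) y); split.
      * apply (mem_act_supported n); assumption.
      * now apply mem_act.
    + exists u; intros z; destruct (Hu z) as [H K]; split; [|intros (y & hy & hz); apply K; now exists y].
      intros h; destruct (H h) as (y & hy & hz); now exists y.
  - intros e x; cbn.
    destruct (supported_ex x) as (n & Hx), (elements x) as (X & f & Hf).
    (* Each subset of [x] is named by the predicate on branches that it induces. Predicates that
       collect no set of the model get an unspecified value, which does no harm because the
       comprehension filters the candidates. *)
    destruct (comprehension (fun y => ~ is_ur y /\ forall z, mem z y -> mem z x) (X -> Prop)
                (fun S => setof (fun z => exists i, S i /\ z = f i)) n) as (u & hu & Hu).
    + intros y [hy H]; exists (fun i => mem (f i) y).
      apply (collects_unique _ _ (fun z => mem z y)); [now split|].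
      assert (C : collects y (fun z => exists i, mem (f i) y /\ z = f i)).
      { split; [easy|]; intros z; split; [|now intros (i & h & ->)].
        intros h; destruct (proj1 (Hf z) (H z h)) as [i ->]; now exists i. }
      destruct (setof_spec _ (ex_intro _ y C)) as [nu' Hs].
      split; [easy|]; intros z; rewrite Hs; symmetry; apply C.
    + intros y [hy H]; apply lowW_set; [easy|].
      intros z hz; exact (lowW_mem _ _ _ (proj1 Hx) (H z hz)).
    + intros p y hp [hy H]; split; [now rewrite is_ur_act|].
      intros z hz; rewrite <- (act_invol (flipS p) z) in hz |- *.
      apply -> mem_act_iff in hz; apply (mem_act_supported n); auto.
    + exists u; split; [exact hu|]; intros y; exact (conj (proj1 (Hu y)) (proj2 (Hu y))).
  - intros e; exists omega; cbn; split.
    + exists zero; split; [apply mem_omega; now exists 0|].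
      split; [apply zero_spec|]; intros y; apply zero_spec.
    + intros x hx; apply mem_omega in hx; destruct hx as [k ->].
      exists (num (S k)); split; [apply mem_omega; now exists (S k)|].
      intros y; exact (conj (proj1 (proj2 (succ_spec _) y)) (proj2 (proj2 (succ_spec _) y))).
  - apply holds_closure, M_Separation.
Qed.

Lemma M_ZFU_R : models M ZFU_R.
Proof.
  intros phi [psi H|psi]; [now apply M_ZU | apply holds_closure, M_Replacement].
Qed.

(** * Injections, ordinals and cardinals as seen in the model *)

Definition Inj (f A B : W) : Prop :=
  (~ is_ur f
   /\ (forall z, mem z f -> exists x, mem x A /\ exists y, mem y B /\ z = opair x y)
   /\ (forall x, mem x A ->
         exists y, mem (opair x y) f /\ forall y', mem (opair x y') f -> y' = y))
  /\ forall x x' y, mem (opair x y) f /\ mem (opair x' y) f -> x = x'.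

Definition Bij (f A B : W) : Prop :=
  Inj f A B /\ forall y, mem y B -> exists x, mem (opair x y) f.

Definition Ord (x : W) : Prop :=
  ~ is_ur x
  /\ (forall y, mem y x -> ~ is_ur y /\ forall z, mem z y -> mem z x)
  /\ (forall y, mem y x -> forall z, mem z x -> mem y z \/ y = z \/ mem z y).

Definition Card (x : W) : Prop :=
  Ord x /\ forall y, mem y x -> ~ exists f, Bij f y x.

(** The formulas for pairs do not say that [p] is a set; having the member [z0] is what rules out a
    urelement. *)
Lemma eq_collection_iff (p : W) P z0 z : P z0 -> collects z P ->
  (forall t, (mem t p -> P t) /\ (P t -> mem t p)) <-> p = z.
Proof.
  intros h0 C; split.
  - intros H; apply (collects_unique _ _ P); [|exact C].
    split; [exact (mem_not_ur _ _ (proj2 (H z0) h0)) | intros t; exact (conj (proj1 (H t)) (proj2 (H t)))].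
  - intros -> t; exact (conj (proj1 (proj2 C t)) (proj2 (proj2 C t))).
Qed.

Lemma sat_upair (e : nat -> M) p x y : sat e (is_upair p x y) <-> e p = upair (e x) (e y).
Proof.
  cbn; apply (eq_collection_iff _ (fun z => z = e x \/ z = e y) (e x)); [now left | apply upair_spec].
Qed.

Lemma sat_opair (e : nat -> M) p x y : sat e (is_opair p x y) <-> e p = opair (e x) (e y).
Proof.
  unfold is_opair; cbn [sat]; setoid_rewrite sat_upair; cbn [scons].
  apply (eq_collection_iff _ (fun z => z = upair (e x) (e x) \/ z = upair (e x) (e y)) (upair (e x) (e x)));
    [now left | apply upair_spec].
Qed.

Lemma sat_maps (e : nat -> M) f x y : sat e (maps f x y) <-> mem (opair (e x) (e y)) (e f).
Proof.
  unfold maps, ex_in; cbn [sat]; setoid_rewrite sat_opair; cbn [scons].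
  split; [intros (z & h & E); now rewrite <- E | intros h; now exists (opair (e x) (e y))].
Qed.

Lemma sat_injection (e : nat -> M) f A B : sat e (is_injection f A B) <-> Inj (e f) (e A) (e B).
Proof.
  unfold is_injection, is_function, all_in, ex_in; cbn [sat].
  setoid_rewrite sat_maps; setoid_rewrite sat_opair; cbn [scons].
  unfold Inj; split; intros [H K]; (split; [exact H|]).
  - intros x x' y; exact (K x x' y).
  - intros x x' y; exact (K x x' y).
Qed.

Lemma sat_bijection (e : nat -> M) f A B : sat e (is_bijection f A B) <-> Bij (e f) (e A) (e B).
Proof.
  unfold is_bijection, all_in; cbn [sat].
  setoid_rewrite sat_maps; rewrite sat_injection; reflexivity.
Qed.

Lemma sat_injects (e : nat -> M) A B : sat e (injects A B) <-> exists f, Inj f (e A) (e B).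
Proof. unfold injects; cbn [sat]; now setoid_rewrite sat_injection. Qed.

Lemma sat_equinumerous (e : nat -> M) A B : sat e (equinumerous A B) <-> exists f, Bij f (e A) (e B).
Proof. unfold equinumerous; cbn [sat]; now setoid_rewrite sat_bijection. Qed.

Lemma sat_cardinal (e : nat -> M) x : sat e (is_cardinal x) <-> Card (e x).
Proof.
  unfold is_cardinal, all_in; cbn [sat]; setoid_rewrite sat_equinumerous; reflexivity.
Qed.

Definition Urs (x : W) : Prop := ~ is_ur x /\ forall y, mem y x -> is_ur y.

Definition Disjoint (x y : W) : Prop := ~ exists z, mem z x /\ mem z y.

Lemma sat_urs (e : nat -> M) x : sat e (set_of_urelements x) <-> Urs (e x).
Proof. reflexivity. Qed.

Lemma sat_cardinal_outside (e : nat -> M) k A :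
  sat e (cardinal_outside k A) <->
  Card (e k) /\ exists D, Urs D /\ (exists f, Bij f D (e k)) /\ Disjoint D (e A).
Proof.
  unfold cardinal_outside; cbn [sat].
  setoid_rewrite sat_equinumerous; rewrite sat_cardinal; reflexivity.
Qed.

Lemma graph_inj (X : Type) (F G : X -> W) A B n :
  (forall i, lowW n (F i) /\ lowW n (G i)) ->
  (forall p i, trivial_below n p ->
     exists i', act (flipS p) (F i) = F i' /\ act (flipS p) (G i) = G i') ->
  (forall i j, F i = F j -> i = j) -> (forall i j, G i = G j -> i = j) ->
  (forall x, mem x A <-> exists i, x = F i) -> (forall i, mem (G i) B) ->
  Inj (graph F G) A B.
Proof.
  intros L H injF injG HA HB; destruct (graph_spec X F G n L H) as [h Hg].
  assert (K : forall x y, mem (opair x y) (graph F G) <-> exists i, x = F i /\ y = G i).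
  { intros x y; rewrite Hg; split; intros [i E]; exists i; [now apply opair_inj|].
    now destruct E as [-> ->]. }
  split; [split; [exact h | split]|].
  - intros z hz; apply Hg in hz; destruct hz as [i ->].
    exists (F i); split; [apply HA; now exists i|].
    exists (G i); split; [apply HB | easy].
  - intros x hx; apply HA in hx; destruct hx as [i ->].
    exists (G i); split; [apply K; now exists i|].
    intros y hy; apply K in hy; destruct hy as (j & E & ->); now rewrite (injF _ _ E).
  - intros x x' y [hx hx']; apply K in hx, hx'.
    destruct hx as (i & -> & ->), hx' as (j & -> & E); now rewrite (injG _ _ E).
Qed.

Lemma graph_bij (X : Type) (F G : X -> W) A B n :
  (forall i, lowW n (F i) /\ lowW n (G i)) ->
  (forall p i, trivial_below n p ->
     exists i', act (flipS p) (F i) = F i' /\ act (flipS p) (G i) = G i') ->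
  (forall i j, F i = F j -> i = j) -> (forall i j, G i = G j -> i = j) ->
  (forall x, mem x A <-> exists i, x = F i) -> (forall y, mem y B <-> exists i, y = G i) ->
  Bij (graph F G) A B.
Proof.
  intros L H injF injG HA HB; split.
  - apply (graph_inj X F G A B n); try easy; intros i; apply HB; now exists i.
  - intros y hy; apply HB in hy; destruct hy as [i ->]; exists (F i).
    apply (graph_spec X F G n L H); now exists i.
Qed.

(** * Countability and the greatest cardinal *)

Lemma injective_unbounded (r : nat -> nat) m :
  (forall i j, r i = r j -> i = j) -> exists i, m <= r i.
Proof.
  intros inj; apply NNPP; intros H.
  assert (K : length (map r (seq 0 (S m))) <= length (seq 0 m)).
  { apply NoDup_incl_length.
    - apply FinFun.Injective_map_NoDup; [exact inj | apply seq_NoDup].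
    - intros x hx; apply in_map_iff in hx; destruct hx as (i & <- & _).
      apply in_seq; cbn; destruct (Nat.lt_ge_cases (r i) m); [lia|].
      destruct H; now exists i. }
  rewrite length_map, !length_seq in K; lia.
Qed.

Lemma least (Q : nat -> Prop) n : Q n -> exists m, Q m /\ forall k, Q k -> m <= k.
Proof.
  induction n as [n IH] using (well_founded_ind Nat.lt_wf_0); intros h.
  destruct (classic (exists k, k < n /\ Q k)) as [(k & hk & hQ)|H]; [exact (IH k hk hQ)|].
  exists n; split; [easy|]; intros k hk; destruct (Nat.lt_ge_cases k n); [|easy].
  destruct H; now exists k.
Qed.

(** Elements of [P] are listed in the order of their codes [r], each time taking the least code
    above the last one; the sequence [s] guarantees that the search never stops. *)
Lemma enumerate (T : Type) (P : T -> Prop) (r : T -> nat) (s : nat -> T) :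
  (forall x y, P x -> P y -> r x = r y -> x = y) ->
  (forall k, P (s k)) -> (forall i j, s i = s j -> i = j) ->
  exists h : nat -> T,
    (forall i j, h i = h j -> i = j) /\ forall x, P x <-> exists k, x = h k.
Proof.
  intros injr Ps injs.
  assert (step : forall m, exists x, P x /\ m <= r x /\ forall y, P y -> m <= r y -> r x <= r y).
  { intros m; destruct (injective_unbounded (fun k => r (s k)) m) as [k hk].
    - intros i j E; apply injs, injr; auto.
    - destruct (least (fun q => m <= q /\ exists x, P x /\ r x = q) (r (s k))) as (q & (hq & x & hx & <-) & H).
      + split; [easy|]; now exists (s k).
      + exists x; split; [easy|]; split; [easy|]; intros y hy hm; apply H; split; [easy|]; now exists y. }
  pose (u := fun m => proj1_sig (constructive_indefinite_description _ (step m))).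
  assert (Hu : forall m, P (u m) /\ m <= r (u m) /\ forall y, P y -> m <= r y -> r (u m) <= r y)
    by (intros m; exact (proj2_sig (constructive_indefinite_description _ (step m)))).
  pose (h := fix h k := match k with 0 => u 0 | S k => u (S (r (h k))) end).
  assert (Ph : forall k, P (h k)) by (intros [|k]; apply Hu).
  assert (mono : forall k, r (h k) < r (h (S k))).
  { intros k; exact (proj1 (proj2 (Hu (S (r (h k)))))). }
  assert (lt : forall i j, i < j -> r (h i) < r (h j)).
  { intros i j l; induction l as [|j l IH]; [apply mono | exact (Nat.lt_trans _ _ _ IH (mono j))]. }
  exists h; split.
  - intros i j E; destruct (Nat.lt_total i j) as [l|[l|l]]; [|easy|];
      apply lt in l; rewrite E in l; lia.
  - intros x; split; [|now intros [k ->]]; intros hx.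
    (* Nothing is skipped: by minimality no code of an element lies strictly between those of [h k]
       and [h (S k)]. *)
    assert (K : forall k, r x <= r (h k) -> exists k, x = h k).
    { induction k as [|k IH]; intros l.
      - exists 0; apply injr; auto; apply Nat.le_antisymm; [easy|].
        apply (Hu 0); [easy | lia].
      - destruct (Nat.lt_ge_cases (r (h k)) (r x)) as [l'|l']; [|auto].
        exists (S k); apply injr; auto; apply Nat.le_antisymm; [easy|].
        now apply (Hu (S (r (h k)))). }
    destruct (injective_unbounded (fun k => r (h k)) (r x)) as [k hk]; [|exact (K k hk)].
    intros i j E; destruct (Nat.lt_total i j) as [l|[l|l]]; [|easy|]; apply lt in l; lia.
Qed.

(** The least member of [beta] outside [alpha], if there is one, turns out to be [alpha] itself. *)
Lemma Ord_subset alpha beta :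
  Ord alpha -> Ord beta -> (forall x, mem x alpha -> mem x beta) ->
  alpha = beta \/ mem alpha beta.
Proof.
  intros (nu & tr & _) (nu' & tr' & lin) sub.
  destruct (classic (forall x, mem x beta -> mem x alpha)) as [H|H].
  - left; apply W_ext; [easy..|]; intros z; split; auto.
  - right; apply not_all_ex_not in H; destruct H as [x H].
    destruct (mem_minimal (fun x => mem x beta /\ ~ mem x alpha) x) as (y & [hy hn] & min).
    { split; [|intros K]; apply NNPP; intros K'; apply H; tauto. }
    replace alpha with y; [easy|].
    apply W_ext; [apply tr', hy | easy |]; intros z; split; intros hz.
    + apply NNPP; intros K; apply (min z hz); split; [exact (proj2 (tr' y hy) z hz) | easy].
    + destruct (lin z (sub z hz) y hy) as [h|[->|h]]; [easy | easy |].
      destruct hn; exact (proj2 (tr z hz) y h).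
Qed.

Lemma Ord_num k : Ord (num k).
Proof.
  split; [apply num_nur|]; split.
  - intros y hy; apply mem_num in hy; destruct hy as (i & h & ->).
    split; [apply num_nur|]; intros z hz; apply mem_num in hz; destruct hz as (j & h' & ->).
    apply mem_num; exists j; split; [lia | easy].
  - intros y hy z hz; apply mem_num in hy, hz.
    destruct hy as (i & _ & ->), hz as (j & _ & ->); rewrite !mem_num.
    destruct (Nat.lt_total i j) as [l|[l|l]]; [left; now exists i | right; left; now subst |
      right; right; now exists j].
Qed.

Lemma Ord_omega : Ord omega.
Proof.
  split; [apply omega_spec|]; split.
  - intros y hy; apply mem_omega in hy; destruct hy as [i ->].
    split; [apply num_nur|]; intros z hz; apply mem_num in hz; destruct hz as (j & _ & ->).
    apply mem_omega; now exists j.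
  - intros y hy z hz; apply mem_omega in hy, hz.
    destruct hy as [i ->], hz as [j ->].
    destruct (Nat.lt_total i j) as [l|[l|l]]; [left | right; left; now subst | right; right];
      apply mem_num; eauto.
Qed.

(** Choosing preimages under a bijection from [num k] would inject all natural numbers into those
    below [k]. *)
Lemma Card_omega : Card omega.
Proof.
  split; [apply Ord_omega|]; intros y hy [f [[(_ & H & F) _] sur]].
  apply mem_omega in hy; destruct hy as [k ->].
  assert (P : forall j, exists i, i < k /\ mem (opair (num i) (num j)) f).
  { intros j; destruct (sur (num j)) as [x hx]; [apply mem_omega; now exists j|].
    destruct (H _ hx) as (x' & hx' & y' & _ & E); apply opair_inj in E; destruct E as [-> _].
    apply mem_num in hx'; destruct hx' as (i & l & ->); now exists i. }
  pose (r := fun j => proj1_sig (constructive_indefinite_description _ (P j))).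
  assert (Hr : forall j, r j < k /\ mem (opair (num (r j)) (num j)) f)
    by (intros j; exact (proj2_sig (constructive_indefinite_description _ (P j)))).
  destruct (injective_unbounded r k) as [j hj]; [|destruct (Hr j); lia].
  intros i j E; destruct (Hr i) as [l hi], (Hr j) as [_ hj]; rewrite <- E in hj.
  destruct (F (num (r i))) as (z & _ & U); [apply mem_num; eauto|].
  apply num_inj; now rewrite (U _ hi), (U _ hj).
Qed.

(** Members of ordinals are sets, and so are their members in turn; no atom occurs that a symmetry
    could move. *)
Lemma act_mem_Ord kappa f x : Ord kappa -> mem x kappa -> act f x = x.
Proof.
  intros (_ & O & _); induction x as [x IH] using (well_founded_ind mem_wf); intros hx.
  destruct (O x hx) as [nu tr].
  apply W_ext; [now rewrite is_ur_act | easy |]; intros z; split; intros hz.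
  - rewrite <- (act_invol f z), mem_act_iff in hz.
    rewrite <- (act_invol f z), (IH _ hz); auto.
  - rewrite <- (IH z hz (tr z hz)); now apply mem_act.
Qed.

Definition code (a : atom) : nat :=
  Cantor.to_nat (kind a, Cantor.to_nat (copy a, Cantor.to_nat (index a, Nat.b2n (side a)))).

Lemma code_inj a b : code a = code b -> a = b.
Proof.
  destruct a as [i j l b'], b as [i' j' l' b'']; unfold code; cbn [kind copy index side].
  intros E; apply Cantor.to_nat_inj in E; apply pair_equal_spec in E; destruct E as [-> E].
  apply Cantor.to_nat_inj in E; apply pair_equal_spec in E; destruct E as [-> E].
  apply Cantor.to_nat_inj in E; apply pair_equal_spec in E; destruct E as [-> E].
  now destruct b', b''.
Qed.

(* There are only countably many atoms, and every bijection between sets of ordinals that exists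
   outside the model lies in it, as it moves no atom. *)
Lemma Card_of_urs kappa D f :
  Card kappa -> Urs D -> Bij f D kappa -> mem kappa omega \/ kappa = omega.
Proof.
  intros [O C] [_ HD] [[(_ & H & F) _] sur].
  destruct (classic (forall x, mem x omega -> mem x kappa)) as [sub|H'].
  - destruct (Ord_subset _ _ Ord_omega O sub) as [E|h]; [now right | exfalso].
    apply (C omega h).
    assert (P : forall y, exists a, mem y kappa -> mem (ur a) D /\ mem (opair (ur a) y) f).
    { intros y; destruct (classic (mem y kappa)) as [hy|]; [|now exists (Atom 0 0 0 false)].
      destruct (sur y hy) as [x hx].
      destruct (H _ hx) as (x' & hx' & y' & _ & E); apply opair_inj in E; destruct E as [<- _].
      destruct (HD x hx') as [a ->]; now exists a. }
    pose (r := fun y => proj1_sig (constructive_indefinite_description _ (P y))).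
    assert (Hr : forall y, mem y kappa -> mem (ur (r y)) D /\ mem (opair (ur (r y)) y) f)
      by (intros y; exact (proj2_sig (constructive_indefinite_description _ (P y)))).
    (* Each member of [kappa] is coded by an atom that [f] sends to it; functionality of [f] makes
       the coding injective, and the numerals show [kappa] infinite. The resulting bijection with
       [omega] contradicts that [kappa] is an initial ordinal above it. *)
    destruct (enumerate W (fun y => mem y kappa) (fun y => code (r y)) num) as (g & injg & Hg).
    + intros x y hx hy E; apply code_inj in E.
      destruct (Hr x hx) as [hD hx'], (Hr y hy) as [_ hy']; rewrite <- E in hy'.
      destruct (F _ hD) as (z & _ & U); now rewrite (U _ hx'), (U _ hy').
    + intros k; apply sub, mem_omega; now exists k.
    + apply num_inj.
    + destruct (lowW_ex kappa) as [n L]; exists (graph num g).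
      apply (graph_bij nat num g omega kappa n); try easy.
      * intros i; split; [apply lowW_num|].
        apply (lowW_mem _ _ _ L), Hg; now exists i.
      * intros p i _; exists i; split; [apply act_num|].
        apply (act_mem_Ord kappa); [easy | apply Hg; now exists i].
      * apply num_inj.
      * apply mem_omega.
  (* Otherwise some numeral is missing from [kappa], and [kappa] is the least such numeral or has it
     as a member, which is absurd. *)
  - left; apply not_all_ex_not in H'; destruct H' as [x H'].
    apply imply_to_and in H'; destruct H' as [hx H'].
    apply mem_omega in hx; destruct hx as [k0 ->].
    destruct (least (fun k => ~ mem (num k) kappa) k0 H') as (k & hk & min).
    destruct (Ord_subset _ _ (Ord_num k) O) as [<-|h]; [|apply mem_omega; now exists k|easy].
    intros x hx; apply mem_num in hx; destruct hx as (i & l & ->).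
    apply NNPP; intros K; apply min in K; lia.
Qed.

Lemma M_Tail_star : holds M Tail_star.
Proof.
  intros e A; cbn [sat]; rewrite sat_urs; cbn [scons]; intros [_ HA].
  destruct (lowW_ex A) as [n L]; exists omega; split.
  - apply sat_cardinal_outside; cbn [scons]; split; [apply Card_omega|].
    (* Kind 0 is never flipped, so one side of a copy is a symmetric set that the index enumerates
       inside the model. Copy [S n] avoids [A], whose atoms are low for [n]. *)
    set (Q := fun a => kind a = 0 /\ copy a = S n /\ side a = false).
    destruct (urset_spec Q (S (S n))) as [nu HQ].
    + intros a (h & h' & _); unfold low; lia.
    + intros p a hp (h & h' & s); repeat split; cbn; try easy.
      now rewrite h, s, hp by now left.
    + exists (urset Q); split; [|split].
      * split; [easy|]; intros y hy; apply HQ in hy; destruct hy as (a & _ & ->); now exists a.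
      * exists (graph (fun l => ur (Atom 0 (S n) l false)) num).
        apply (graph_bij _ _ _ _ _ (S (S n))).
        -- intros l; split; [apply lowW_ur; unfold low; cbn; lia | apply lowW_num].
        -- intros p l hp; exists l; split; [|apply act_num].
           rewrite act_ur; cbn; unfold flip; cbn; now rewrite hp by now left.
        -- intros i j E; apply ur_inj in E; congruence.
        -- apply num_inj.
        -- intros x; rewrite HQ; split.
           ++ intros ([i j l b] & (h & h' & s) & ->); cbn in *; subst; now exists l.
           ++ intros [l ->]; eexists; split; [|reflexivity]; easy.
        -- apply mem_omega.
      * intros (z & hz & hA); apply HQ in hz; destruct hz as (a & (_ & h & _) & ->).
        apply (lowW_mem _ _ _ L), lowW_ur in hA; unfold low in hA; lia.
  - intros k Hk; apply sat_cardinal_outside in Hk; cbn [scons] in *.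
    destruct Hk as (C & D & HD & (f & Hf) & _).
    exact (Card_of_urs k D f C HD Hf).
Qed.

(** * Failure of Tail and Collection *)

(** Russell's socks: for [i > 0], any given support leaves all but finitely many of the pairs free
    to be flipped. *)
Definition socks (i j : nat) : W := urset (fun a => kind a = i /\ copy a = j).

Lemma socks_spec i j : collects (socks i j) (fun z => exists a, (kind a = i /\ copy a = j) /\ z = ur a).
Proof.
  apply (urset_spec _ (S (i + j))); [|easy].
  intros a [h h']; unfold low; lia.
Qed.

(** It meets every kind, and belongs to the model because [low] exempts copy 0 from the bound on
    kinds. *)
Definition base : W := urset (fun a => copy a = 0).

Lemma base_spec : collects base (fun z => exists a, copy a = 0 /\ z = ur a).
Proof. apply (urset_spec _ 0); [now left | easy]. Qed.

Lemma Urs_base : Urs base.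
Proof.
  split; [apply base_spec|]; intros y hy; apply base_spec in hy.
  destruct hy as (a & _ & ->); now exists a.
Qed.

Lemma Urs_socks i j : Urs (socks i j).
Proof.
  split; [apply socks_spec|]; intros y hy; apply socks_spec in hy.
  destruct hy as (a & _ & ->); now exists a.
Qed.

Lemma Disjoint_socks i j : Disjoint (socks i (S j)) base.
Proof.
  intros (z & h & h'); apply socks_spec in h; apply base_spec in h'.
  destruct h as (a & (_ & h) & ->), h' as (b & h' & E); apply ur_inj in E; subst; lia.
Qed.

(* An injection supported by [n] would be fixed by the flip of the pair number [n] of [socks i j],
   which fixes all the values. *)
Lemma socks_no_Inj i j f B :
  0 < i -> (forall y, mem y B -> exists a, kind a <> i /\ y = ur a) -> ~ Inj f (socks i j) B.
Proof.
  intros hi HB [(_ & H & F) inj].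
  destruct (supported_ex f) as (n & _ & Hf).
  set (p := fun i' l => (i' =? i) && (l =? n)).
  assert (hp : trivial_below n p).
  { intros i' l h; unfold p; destruct (Nat.eqb_spec i' i); [|easy].
    destruct (Nat.eqb_spec l n); [lia | easy]. }
  destruct (F (ur (Atom i j n false))) as (y & hy & _).
  { apply socks_spec; eexists; split; [|reflexivity]; easy. }
  assert (Hy : act (flipS p) y = y).
  { destruct (H _ hy) as (x & _ & y' & hy' & E); apply opair_inj in E; destruct E as [_ <-].
    destruct (HB y hy') as ([i' j' l b] & h & ->); rewrite act_ur; cbn in *.
    unfold flip, p; cbn; now rewrite (proj2 (Nat.eqb_neq i' i)). }
  pose proof (mem_act (flipS p) _ _ hy) as hy'.
  rewrite (Hf p hp), act_opair, Hy, act_ur in hy'.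
  pose proof (inj _ _ _ (conj hy hy')) as E; apply ur_inj in E; revert E.
  cbn; unfold flip, p; cbn; now rewrite !Nat.eqb_refl.
Qed.

(** An atom of [B] is low for [n] without being in copy 0, so its kind is below [n] and differs from
    [S n]. Both failures rest on this. *)
Lemma no_Inj_outside_base n B f j :
  lowW n B -> Urs B -> Disjoint B base -> ~ Inj f (socks (S n) j) B.
Proof.
  intros L [_ HB] dis; apply socks_no_Inj; [lia|].
  intros y hy; destruct (HB y hy) as [a ->]; exists a; split; [|easy].
  apply (lowW_mem _ _ _ L) in hy as l; apply lowW_ur in l.
  destruct l as [l|l]; [|lia]; destruct dis; exists (ur a); split; [easy|].
  apply base_spec; now exists a.
Qed.

Lemma M_not_Tail : ~ holds M Tail.
Proof.
  intros H; specialize (H (fun _ => zero) base); cbn [sat] in H.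
  destruct (H Urs_base) as (B & U & dis & K); cbn [scons] in *.
  destruct (lowW_ex B) as [n L].
  (* The kind [S n] exceeds all kinds met by the alleged tail, and copy 1 is disjoint from
     [base]. *)
  specialize (K (socks (S n) 1)); rewrite sat_injects in K; cbn [scons] in K.
  destruct K as [f Hf].
  - split; [apply Urs_socks | apply Disjoint_socks].
  - exact (no_Inj_outside_base n B f 1 L U dis Hf).
Qed.

(** Keeping pair and side while changing the copy is invariant, because a flip acts on all copies of
    a pair at once. *)
Lemma socks_copy i : exists f, Inj f (socks i 0) (socks i 1).
Proof.
  exists (graph (fun c : nat * bool => ur (Atom i 0 (fst c) (snd c)))
                (fun c : nat * bool => ur (Atom i 1 (fst c) (snd c)))).
  apply (graph_inj _ _ _ _ _ (S (S i))).
  - intros [l b]; split; apply lowW_ur; unfold low; cbn; lia.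
  - intros p [l b] _; exists (l, xorb (p i l) b); now rewrite !act_ur.
  - intros [] [] E; apply ur_inj in E; cbn in E; congruence.
  - intros [] [] E; apply ur_inj in E; cbn in E; congruence.
  - intros x; split.
    + intros h; apply socks_spec in h; destruct h as ([i' j l b] & [h h'] & ->).
      cbn in *; subst; now exists (l, b).
    + intros [[l b] ->]; apply socks_spec; eexists; split; [|reflexivity]; easy.
  - intros [l b]; apply socks_spec; eexists; split; [|reflexivity]; easy.
Qed.

Lemma act_socks p i j : act (flipS p) (socks i j) = socks i j.
Proof.
  apply W_ext; rewrite ?is_ur_act; try apply socks_spec.
  assert (K : forall z, mem z (socks i j) -> mem (act (flipS p) z) (socks i j)).
  { intros z hz; apply socks_spec in hz; destruct hz as (a & h & ->).
    rewrite act_ur; apply socks_spec; now exists (flip p a). }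
  intros z; rewrite <- (act_invol (flipS p) z), mem_act_iff, act_invol.
  split; intros h; [|now apply K].
  rewrite <- (act_invol (flipS p) z); now apply K.
Qed.

Lemma family_of_socks :
  exists w, forall x, mem x w <-> exists i, x = socks i 0.
Proof.
  destruct (comprehension (fun x => exists i, x = socks i 0) nat (fun i => socks i 0) 0)
    as (w & _ & H); [easy|..|now exists w].
  - intros y [i ->]; apply lowW_set; [apply socks_spec|].
    intros z hz; apply socks_spec in hz; destruct hz as (a & [_ h] & ->).
    apply lowW_ur; now left.
  - intros p y _ [i ->]; exists i; apply act_socks.
Qed.

Lemma M_not_Collection : ~ models M Collection.
Proof.
  intros H.
  (* Variable 0 is the set sought, 1 the given family member, and 2 the parameter, to be interpreted
     by [base]. *)
  set (phi := And (set_of_urelements 0) (And (disjoint 0 2) (injects 1 0))).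
  assert (K : holds M (Collection_inst phi)) by (apply holds_closure, H; constructor).
  assert (Hphi : forall e : nat -> M, sat e phi <->
    Urs (e 0) /\ Disjoint (e 0) (e 2) /\ exists f, Inj f (e 1) (e 0)).
  { intros e; unfold phi; cbn [sat]; now rewrite sat_injects. }
  clearbody phi.
  destruct family_of_socks as [w Hw].
  specialize (K (fun _ => base) w); cbn [sat all_in ex_in scons] in K.
  destruct K as [v Hv].
  { intros x hx; apply Hw in hx; destruct hx as [i ->]; exists (socks i 1).
    rewrite sat_ren, Hphi; cbn; split; [apply Urs_socks|].
    split; [apply Disjoint_socks | apply socks_copy]. }
  (* All members of a collecting set share its bound [n], so none of them can serve the socks of
     kind [S n]. *)
  destruct (lowW_ex v) as [n L].
  destruct (Hv (socks (S n) 0)) as (y & hy & S); [apply Hw; now exists (S n)|].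
  rewrite sat_ren, Hphi in S; cbn in S; destruct S as (U & dis & f & Hf).
  exact (no_Inj_outside_base n y f 0 (lowW_mem _ _ _ L hy) U dis Hf).
Qed.

Theorem theorem2p31 (con_ZF : consistent ZF) :
  exists M : structure unit,
    models M ZFU_R /\ holds M Tail_star /\ ~ models M Collection /\ ~ holds M Tail.
Proof.
  exists M; split; [exact M_ZFU_R|]; split; [exact M_Tail_star|].
  split; [exact M_not_Collection | exact M_not_Tail].
Qed.
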